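(* Let $\tau\colon E_\bullet\to E_\bullet$ be defined on generators by $s\mapsto t$, $t\mapsto s$ in degree $0$, and by $(p,b_1\cdots b_{n+1})\mapsto(p,(b_1\oplus1)b_2\cdots b_{n+1})$ in degree $n+1>0$, for every polarised noncrossing partition $(p,b_1\cdots b_{n+1})$ of degree $n$. Then $\tau$ is an involutive automorphism of augmented chain complexes.
   Context: Here $\mathbb{N}$ includes $0$, $\mathbb{F}_2=\{0,1\}$ is the field with two elements (''bits'') with addition $\oplus$, $(-)^m$ denotes $(-1)^m$, and $\mathbb{Z}B$ is the free abelian group on a set $B$. Noncrossing partitions. A partition of degree $n$ is a partition $\{\pi_1,\dots,\pi_k\}$ of $\{1,\dots,n\}$ into non-empty blocks; it is noncrossing if for all $i,j$, all $a,a'\in\pi_i$, $b,b'\in\pi_j$, $a<b<a'<b'$ implies $i=j$. The empty partition $\{\}$ is the only partition of degree $0$. For $i,m\in\mathbb{N}$ let $\mathsf{s}_i^m\colon\mathbb{N}\to\mathbb{N}$ send $x\mapsto x$ if $x<i$ and $x\mapsto x+m$ if $x\ge i$. For noncrossing partitions $p=\{\pi_1,\dots,\pi_k\}$ of degree $n$, $q=\{\rho_1,\dots,\rho_\ell\}$ of degree $m$, and $i\in\{1,\dots,n+1\}$, set $p\circ_i q=\{\mathsf{s}_i^m(\pi_1),\dots,\mathsf{s}_i^m(\pi_k),\mathsf{s}_1^{i-1}(\rho_1),\dots,\mathsf{s}_1^{i-1}(\rho_\ell)\}$, a noncrossing partition of degree $n+m$. Polarised noncrossing partitions. A polarised noncrossing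 partition of degree $n$ is a pair $(p,b_1\cdots b_{n+1})$ (also written $(p,b_\bullet)$) of a noncrossing partition $p$ of degree $n$ and a string of $n+1$ bits; their set is $\mathrm{NCP}_{\mathbb{F}_2}(n)$. For $(p,b_\bullet)$ of degree $n$, $(q,c_\bullet)$ of degree $m$, $i\in\{1,\dots,n+1\}$, set $(p,b_\bullet)\circ_i(q,c_\bullet)=(p\circ_i q,\ b_1\cdots b_{i-1}(b_i\oplus c_1)\cdots(b_i\oplus c_{m+1})b_{i+1}\cdots b_{n+1})$. For $b\in\{0,1\}$ let $\psi_0^b=(\{\},b)$, and for $n>0$ let $\psi_n^b=(\{\{1,\dots,n\}\},b0\cdots0)$. Rightmost decomposition. Every polarised noncrossing partition has a unique factorisation of the form $(\dots((\psi_0^0\circ_{i_1}\psi_{m_1}^{c_1})\circ_{i_2}\psi_{m_2}^{c_2})\dots)\circ_{i_k}\psi_{m_k}^{c_k}$ with $k\ge0$, $i_1<\dots<i_k$, and, for each $j$, $m_j>0$ or $c_j=1$; it is called its rightmost decomposition and $k$ its length. Those of length at most $1$ are exactly the $\psi_m^c$. The augmented chain complex $E_\bullet$. An augmented chain complex is a chain complex of abelian groups in non-negative degrees with differential $\mathrm{d}$ together with a homomorphism $\mathrm{e}$ from degree $0$ to $\mathbb{Z}$ such that $\mathrm{e}\mathrm{d}=0$; morphisms are degreewise homomorphisms of abelian groups commuting with the differentials and augmentations. Put $E_0=\mathbb{Z}\{s,t\}$, $E_{n+1}=\mathbb{Z}(\mathrm{NCP}_{\mathbb{F}_2}(n))$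 for $n\in\mathbb{N}$, $\mathrm{e}s=\mathrm{e}t=1$. Define $\mathrm{d}$ on generators by induction on the length of the rightmost decomposition, extending $-\circ_i-$ bilinearly where necessary: $\mathrm{d}\psi_0^c=(-)^c(t-s)$; $\mathrm{d}\psi_{m+1}^c=\psi_m^{c\oplus1}+(-)^m\psi_m^c$. If the rightmost decomposition is $(p',b'_\bullet)\circ_i\psi_m^c$ with $\psi_m^c$ its final factor and $p'$ of degree $k>0$, then: - if $i=k+1$: $\mathrm{d}((p',b'_\bullet)\circ_i\psi_0^1)=-\mathrm{d}(p',b'_\bullet)$ and $\mathrm{d}((p',b'_\bullet)\circ_i\psi_{m+1}^c)=(p',b'_\bullet)\circ_i\mathrm{d}\psi_{m+1}^c$; - if $i<k+1$: $\mathrm{d}((p',b'_\bullet)\circ_i\psi_0^1)=\mathrm{d}(p',b'_\bullet)\circ_i\psi_0^1$ and $\mathrm{d}((p',b'_\bullet)\circ_i\psi_{m+1}^c)=\mathrm{d}(p',b'_\bullet)\circ_i\psi_{m+1}^c+(-)^{k+1-i}(p',b'_\bullet)\circ_i\mathrm{d}\psi_{m+1}^c$. This is a well-defined augmented chain complex. *)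

(* Defs.v *)
From HB Require Import structures.
From mathcomp Require Import all_boot all_order all_algebra.
From mathcomp Require Import finmap freeg zify.

Set Implicit Arguments.
Unset Strict Implicit.
Unset Printing Implicit Defensive.

Import GRing.Theory Num.Theory.
Local Open Scope fset_scope.
Local Open Scope nat_scope.

(* Partitions live on the labels 1, ..., n, as sets of blocks of naturals. *)
Definition noncrossing (p : {fset {fset nat}}) : bool :=
  all (fun A : {fset nat} => all (fun B : {fset nat} =>
    all (fun a => all (fun a' => all (fun b => all (fun b' =>
      [&& a < b, b < a' & a' < b'] ==> (A == B)) B) B) A) A) p) p.

Definition full (n : nat) : {fset nat} := [fset x in iota 1 n].

Definition is_ncp (n : nat) (p : {fset {fset nat}}) : bool :=
  [&& fset0 \notin p, trivIfset p, fcover p == full n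
    & noncrossing p].

Definition shift (i m x : nat) : nat := if x < i then x else x + m.

(* [m] is the degree of [q]; the case [i = 0] is never used. *)
Definition comp_part (i m : nat) (p q : {fset {fset nat}}) :
    {fset {fset nat}} :=
  [fset shift i m @` A | A : {fset nat} in p]
    `|` [fset shift 1 i.-1 @` B | B : {fset nat} in q].

(* b_1 .. b_(i-1) (b_i (+) c_1) .. (b_i (+) c_(m+1)) b_(i+1) .. b_(n+1) *)
Definition comp_bits (i : nat) (b c : bitseq) : bitseq :=
  take i.-1 b ++ [seq nth false b i.-1 (+) x | x <- c] ++ drop i b.

(* A pair (p, b_1 ... b_(n+1)); the degree n is [(size b).-1]. *)
Definition raw_pncp : Type := ({fset {fset nat}} * bitseq)%type.

Definition raw_comp (i : nat) (x y : raw_pncp) : raw_pncp :=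
  (comp_part i (size y.2).-1 x.1 y.1, comp_bits i x.2 y.2).

Definition raw_psi (m : nat) (c : bool) : raw_pncp :=
  (if m == 0 then fset0 else [fset full m], c :: nseq m false).

Definition is_pncp (n : nat) (x : raw_pncp) : bool :=
  is_ncp n x.1 && (size x.2 == n.+1).

Lemma noncrossingP (p : {fset {fset nat}}) :
  reflect (forall A B : {fset nat}, A \in p -> B \in p ->
    forall a a' b b', a \in A -> a' \in A -> b \in B -> b' \in B ->
      a < b -> b < a' -> a' < b' -> A = B) (noncrossing p).
Proof.
apply: (iffP allP) => H.
  move=> A B Ap Bp a a' b b' aA a'A bB b'B l1 l2 l3.
  have /allP/(_ _ Bp)/allP/(_ _ aA)/allP/(_ _ a'A)/allP/(_ _ bB) := H _ Ap.
  by move=> /allP/(_ _ b'B); rewrite l1 l2 l3 => /eqP.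
move=> A Ap; apply/allP => B Bp; apply/allP => a aA; apply/allP => a' a'A.
apply/allP => b bB; apply/allP => b' b'B; apply/implyP => /and3P[l1 l2 l3].
by apply/eqP; apply: (H A B Ap Bp a a' b b').
Qed.

Record ncp_spec n (p : {fset {fset nat}}) : Prop := NcpSpec {
  ncp_ne : forall A, A \in p -> exists a, a \in A;
  ncp_rg : forall A a, A \in p -> a \in A -> 1 <= a <= n;
  ncp_cov : forall a, 1 <= a <= n -> exists2 A : {fset nat}, A \in p & a \in A;
  ncp_dj : forall A B a, A \in p -> B \in p -> a \in A -> a \in B -> A = B;
  ncp_nc : forall A B : {fset nat}, A \in p -> B \in p ->
    forall a a' b b', a \in A -> a' \in A -> b \in B -> b' \in B ->
      a < b -> b < a' -> a' < b' -> A = B }.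

Lemma in_full n a : (a \in full n) = (1 <= a <= n).
Proof. by rewrite !inE mem_iota add1n ltnS. Qed.

Lemma is_ncpP n p : reflect (ncp_spec n p) (is_ncp n p).
Proof.
apply: (iffP and4P) => [[h0 /trivIfsetP ht /eqP hc /noncrossingP hn]|[h1 h2 h3 h4 h5]].
  split=> //.
  - move=> A Ap; have [A0|] := eqVneq A fset0; last by case/fset0Pn => a; exists a.
    by rewrite -A0 Ap in h0.
  - move=> A a Ap aA; rewrite -in_full -hc.
    by apply/bigfcupP; exists A; rewrite ?Ap.
  - move=> a; rewrite -in_full -hc => /bigfcupP[A /andP[Ap _] aA]; by exists A.
  - move=> A B a Ap Bp aA aB; apply/eqP; apply: contraT => nAB.
    by have /fdisjointP/(_ _ aA) := ht A B Ap Bp nAB; rewrite aB.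
split.
- by apply/negP => /h1[a]; rewrite inE.
- apply/trivIfsetP => A B Ap Bp nAB; apply/fdisjointP => a aA; apply/negP => aB.
  by rewrite (h4 A B a) ?eqxx in nAB.
- apply/eqP/fsetP => a; rewrite in_full; apply/bigfcupP/idP.
    by move=> [A /andP[Ap _] aA]; apply: h2 aA.
  by case/h3 => A Ap aA; exists A; rewrite ?Ap.
- exact/noncrossingP.
Qed.

Lemma mem_comp_part i m p q (A : {fset nat}) :
  reflect ((exists2 B : {fset nat}, B \in p & A = (shift i m @` B)%fset) \/
           (exists2 B : {fset nat}, B \in q & A = (shift 1 i.-1 @` B)%fset))
    (A \in comp_part i m p q).
Proof.
rewrite /comp_part in_fsetU; apply: (iffP orP) => -[].
- by case/imfsetP => B /= Bp ->; left; exists B.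
- by case/imfsetP => B /= Bp ->; right; exists B.
- by case=> B Bp ->; left; apply/imfsetP; exists B.
- by case=> B Bp ->; right; apply/imfsetP; exists B.
Qed.

Lemma in_shift i m (A : {fset nat}) a :
  reflect (exists2 x, x \in A & a = shift i m x) (a \in (shift i m @` A)%fset).
Proof. by apply: (iffP (imfsetP _ _ _ _)) => -[x xA ->]; exists x. Qed.

Lemma shift_inj i m : injective (shift i m).
Proof. by move=> x y; rewrite /shift; case: (ltnP x i); case: (ltnP y i); lia. Qed.

Lemma shift_lt i m x y : x < y -> shift i m x < shift i m y.
Proof. by rewrite /shift; case: (ltnP x i); case: (ltnP y i); lia. Qed.

Lemma shift_ltE i m x y : (shift i m x < shift i m y) = (x < y).
Proof. by rewrite /shift; case: (ltnP x i); case: (ltnP y i); lia. Qed.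

Lemma shift_img_inj i m (A B : {fset nat}) :
  (shift i m @` A = shift i m @` B)%fset -> A = B.
Proof.
move=> e; apply/fsetP => x; apply/idP/idP => xA.
  have /in_shift[y yB /shift_inj ->//] : shift i m x \in (shift i m @` B)%fset.
  by rewrite -e; apply/in_shift; exists x.
have /in_shift[y yB /shift_inj ->//] : shift i m x \in (shift i m @` A)%fset.
by rewrite e; apply/in_shift; exists x.
Qed.

Lemma comp_part_ncp n m i p q : 1 <= i <= n.+1 ->
  is_ncp n p -> is_ncp m q -> is_ncp (n + m) (comp_part i m p q).
Proof.
move=> hi /is_ncpP[pne prg pcov pdj pnc] /is_ncpP[qne qrg qcov qdj qnc].
have sE x : 1 <= x -> shift 1 i.-1 x = x + i.-1 by rewrite /shift; case: (ltnP x 1); lia.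
apply/is_ncpP; split.
- move=> A /mem_comp_part[[B /pne[b bB] ->]|[B /qne[b bB] ->]].
    by exists (shift i m b); apply/in_shift; exists b.
  by exists (shift 1 i.-1 b); apply/in_shift; exists b.
- move=> A a /mem_comp_part[[B Bp ->]|[B Bq ->]] /in_shift[b bB ->].
    by have := prg _ _ Bp bB; rewrite /shift; case: (ltnP b i); lia.
  by have h := qrg _ _ Bq bB; rewrite sE; lia.
- move=> a ha; have [ai|ia] := ltnP a i.
    have [|A Ap aA] := pcov a; first lia.
    exists (shift i m @` A)%fset; first by apply/mem_comp_part; left; exists A.
    by apply/in_shift; exists a => //; rewrite /shift ai.
  have [ai|im] := ltnP a (i + m).
    have [|A Aq aA] := qcov (a - i.-1); first lia.
    exists (shift 1 i.-1 @` A)%fset; first by apply/mem_comp_part; right; exists A.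
    by apply/in_shift; exists (a - i.-1) => //; rewrite sE; lia.
  have [|A Ap aA] := pcov (a - m); first lia.
  exists (shift i m @` A)%fset; first by apply/mem_comp_part; left; exists A.
  by apply/in_shift; exists (a - m) => //; rewrite /shift; case: (ltnP (a - m) i); lia.
- move=> A B a /mem_comp_part[[A' A'p ->]|[A' A'p ->]]
    /mem_comp_part[[B' B'p ->]|[B' B'p ->]] /in_shift[x xA ->] /in_shift[y yB].
  + by move/shift_inj => e; (suff -> : A' = B' by []); apply: (pdj _ _ x) => //; rewrite ?e.
  + have h := qrg _ _ B'p yB; rewrite sE; last by lia.
    by rewrite /shift; case: (ltnP x i); lia.
  + have h := qrg _ _ A'p xA; rewrite sE; last by lia.
    by rewrite /shift; case: (ltnP y i); lia.
  + by move/shift_inj => e; (suff -> : A' = B' by []); apply: (qdj _ _ x) => //; rewrite ?e.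
- move=> A B /mem_comp_part[[A' A'p ->]|[A' A'p ->]]
    /mem_comp_part[[B' B'p ->]|[B' B'p ->]] a a' b b'
    /in_shift[x xA ->] /in_shift[x' x'A ->] /in_shift[y yB ->] /in_shift[y' y'B ->].
  + rewrite !shift_ltE => l1 l2 l3; suff -> : A' = B' by [].
    exact: (pnc _ _ A'p B'p x x' y y').
  + have h := qrg _ _ B'p yB; have h' := qrg _ _ B'p y'B; rewrite !(@sE y) ?(@sE y'); try lia.
    by rewrite /shift; case: (ltnP x i); case: (ltnP x' i); lia.
  + have h := qrg _ _ A'p xA; have h' := qrg _ _ A'p x'A; rewrite !(@sE x) ?(@sE x'); try lia.
    by rewrite /shift; case: (ltnP y i); case: (ltnP y' i); lia.
  + rewrite !shift_ltE => l1 l2 l3; suff -> : A' = B' by [].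
    exact: (qnc _ _ A'p B'p x x' y y').
Qed.

Lemma size_comp_bits n m i b c : 1 <= i <= n.+1 -> size b = n.+1 ->
  size c = m.+1 -> size (comp_bits i b c) = (n + m).+1.
Proof.
move=> hi sb sc; rewrite /comp_bits !size_cat size_map size_take size_drop sb sc.
by case: ltnP; lia.
Qed.

Lemma nth_comp_bits n m i b c j : 1 <= i <= n.+1 -> size b = n.+1 ->
  size c = m.+1 -> nth false (comp_bits i b c) j =
  if j < i.-1 then nth false b j
  else if j < i + m then nth false b i.-1 (+) nth false c (j - i.-1)
  else nth false b (j - m).
Proof.
move=> hi sb sc; rewrite /comp_bits nth_cat size_take sb.
have -> : i.-1 < n.+1 by lia.
case: ltnP => h1; first by rewrite nth_take.
rewrite nth_cat size_map sc; case: ltnP => h2; case: ltnP => h3; try lia.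
  by rewrite (nth_map false) // sc.
by rewrite nth_drop; congr nth; lia.
Qed.

Lemma raw_comp_pncp n m i x y : 1 <= i <= n.+1 ->
  is_pncp n x -> is_pncp m y -> is_pncp (n + m) (raw_comp i x y).
Proof.
move=> hi /andP[px /eqP sx] /andP[py /eqP sy]; apply/andP; split => /=.
  by rewrite sy; apply: comp_part_ncp.
by rewrite (size_comp_bits hi sx sy).
Qed.

Lemma raw_psi_pncp m c : is_pncp m (raw_psi m c).
Proof.
rewrite /is_pncp /= size_nseq eqxx andbT; apply/is_ncpP.
case: m => [|m] /=; first by split=> //= a; lia.
split=> //.
- by move=> A /fset1P ->; exists 1; rewrite in_full.
- by move=> A a /fset1P ->; rewrite in_full.
- by move=> a ha; exists (full m.+1); rewrite ?fset11 ?in_full.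
- by move=> A B a /fset1P -> /fset1P ->.
- by move=> A B /fset1P -> /fset1P ->.
Qed.

Lemma comp_part0 i p : comp_part i 0 p fset0 = p.
Proof.
have s0 (A : {fset nat}) : (shift i 0 @` A)%fset = A.
  apply/fsetP => a; apply/in_shift/idP => [[x xA ->]|aA].
    by rewrite /shift addn0 if_same.
  by exists a => //; rewrite /shift addn0 if_same.
apply/fsetP => A; apply/mem_comp_part/idP => [[[B Bp ->]|[B]]|Ap].
- by rewrite s0.
- by rewrite inE.
- by left; exists A; rewrite ?s0.
Qed.

Lemma raw_comp_unit n i x : 1 <= i <= n.+1 -> is_pncp n x ->
  raw_comp i x (raw_psi 0 false) = x.
Proof.
case: x => p b hi /andP[/= _ /eqP sb]; rewrite /raw_comp /= comp_part0 //.
congr pair; apply: (@eq_from_nth _ false) => [|j _].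
  by rewrite (size_comp_bits hi sb (m := 0)) // addn0 sb.
rewrite (nth_comp_bits _ hi sb (m := 0)) //; case: ltnP => // h1.
case: ltnP => h2; last by rewrite subn0.
have -> : j = i.-1 by lia.
by rewrite subnn /= addbF.
Qed.

(* [(i, m, c)] stands for "o_i psi_m^c".  A word lists the factors from the last
   one to the first: [:: (i_k, m_k, c_k); ...; (i_1, m_1, c_1)] denotes
   (...(psi_0^0 o_(i_1) psi_(m_1)^(c_1)) ...) o_(i_k) psi_(m_k)^(c_k). *)
Definition factor : Type := (nat * nat * bool)%type.

Definition fpos (f : factor) : nat := f.1.1.

Fixpoint wdeg (w : seq factor) : nat :=
  if w is (_, m, _) :: w' then wdeg w' + m else 0.

Fixpoint weval (w : seq factor) : raw_pncp :=
  if w is (i, m, c) :: w' then raw_comp i (weval w') (raw_psi m c)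
  else raw_psi 0 false.

Definition wbelow (i : nat) (w : seq factor) : bool :=
  all (fun f => fpos f < i) w.

(* i_1 < ... < i_k, each composition is defined, and no factor is psi_0^0. *)
Fixpoint rightmost (w : seq factor) : bool :=
  if w is (i, m, c) :: w' then
    [&& 1 <= i <= (wdeg w').+1, (0 < m) || c, wbelow i w' & rightmost w']
  else true.

Lemma weval_pncp w : rightmost w -> is_pncp (wdeg w) (weval w).
Proof.
elim: w => [|[[i m] c] w IH] /=; first by move=> _; apply: raw_psi_pncp.
by case/and4P => hi _ _ /IH h; apply: raw_comp_pncp => //; apply: raw_psi_pncp.
Qed.

Lemma wbelow_mono i j w : i <= j -> wbelow i w -> wbelow j w.
Proof. by move=> ij; apply: sub_all => f /leq_trans; apply. Qed.

Lemma wbelow_block i w (A : {fset nat}) : rightmost w -> wbelow i w ->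
  A \in (weval w).1 -> exists2 a, a \in A & a < i.
Proof.
elim: w i A => [|[[j m] c] w IH] i A; first by rewrite inE.
move=> /= /and4P[hj hmc hb hr] /andP[ji bi].
have sE x : 1 <= x -> shift 1 j.-1 x = x + j.-1.
  by rewrite /shift; case: (ltnP x 1); lia.
rewrite /fpos /= in ji.
move=> /mem_comp_part[[B Bp ->]|[B Bp ->]].
  have [b bB bj] := IH _ _ hr hb Bp.
  exists (shift j (size (raw_psi m c).2).-1 b); first by apply/in_shift; exists b.
  by rewrite /shift bj; lia.
case: m hmc Bp => [|m] hmc; first by rewrite /= inE.
move=> /= /fset1P ->; exists j => //; apply/in_shift; exists 1.
  by rewrite in_full.
by rewrite sE //; lia.
Qed.

Lemma weval_comp1 i m c w : rightmost ((i, m, c) :: w) ->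
  (weval ((i, m, c) :: w)).1 = comp_part i m (weval w).1 (raw_psi m c).1.
Proof. by move=> _ /=; rewrite size_nseq. Qed.

Lemma size_psi m c : size (raw_psi m c).2 = m.+1.
Proof. by rewrite /= size_nseq. Qed.

Lemma size_weval w : rightmost w -> size (weval w).2 = (wdeg w).+1.
Proof. by move/weval_pncp => /andP[_ /eqP]. Qed.

Lemma nth_weval i m c w k : rightmost ((i, m, c) :: w) ->
  nth false (weval ((i, m, c) :: w)).2 k =
  if k < i.-1 then nth false (weval w).2 k
  else if k < i + m then nth false (weval w).2 i.-1 (+) ((k == i.-1) && c)
  else nth false (weval w).2 (k - m).
Proof.
move=> /= /and4P[hi _ _ /size_weval hs].
rewrite (nth_comp_bits _ hi hs (size_psi m c)).
case: ltnP => // h1; case: ltnP => // h2; congr addb.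
have [->|h3] := eqVneq k i.-1; first by rewrite subnn.
have [q ->] : exists q, k - i.-1 = q.+1.
  by exists (k - i.-1).-1; move/eqP: h3 => h3; lia.
by rewrite /= nth_nseq if_same.
Qed.

Lemma rightmost_wbelow w : rightmost w -> wbelow (wdeg w).+2 w.
Proof.
elim: w => [|[[i m] c] w IH] //= /and4P[hi _ hb _].
apply/andP; split; first by rewrite /fpos /=; lia.
by apply: wbelow_mono hb; lia.
Qed.

Lemma in_shift_full i m a : 0 < i ->
  (a \in (shift 1 i.-1 @` full m)%fset) = (i <= a < i + m).
Proof.
move=> i0; apply/in_shift/idP => [[x]|h].
  by rewrite in_full /shift => h ->; case: (ltnP x 1); lia.
by exists (a - i.-1); rewrite ?in_full /shift; [lia|case: (ltnP (a - i.-1) 1); lia].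
Qed.

Lemma block_gap n p (A : {fset nat}) j : is_ncp n p -> A \in p -> 
  (forall a, a \in A -> j < a) -> j.+1 \in A ->
  (forall B, B \in p -> exists2 b, b \in B & b <= j.+1) ->
  exists2 m, 0 < m & forall a, (a \in A) = (j < a <= j + m).
Proof.
move=> /is_ncpP[pne prg pcov pdj pnc] Ap Aj jA Bj.
have cl x y : x \in A -> j < y -> y <= x -> y \in A.
  move=> xA jy yx.
  have [|B Bp yB] := pcov y; first by have := prg _ _ Ap xA; lia.
  have [b bB bj] := Bj _ Bp.
  have [eb|nb] := eqVneq b j.+1.
    by rewrite (pdj A B j.+1) // -eb.
  have [ey|ny] := eqVneq y x; first by rewrite ey.
  have [ej|nj] := eqVneq y j.+1; first by rewrite ej.
  by rewrite -(pnc B A Bp Ap b y j.+1 x) //; move/eqP: nb; move/eqP: ny; move/eqP: nj; lia.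
have ex : exists m, j + m.+1 \notin A.
  by exists n; apply/negP => /(prg _ _ Ap); lia.
case: (ex_minnP ex) => m hm hmin; exists m.
  by case: m hm {hmin} => //; rewrite addn1 jA.
move=> a; apply/idP/idP => [aA|/andP[l1 l2]].
  rewrite Aj //= leqNgt; apply: contraNN hm => hlt; apply: (cl a) => //; lia.
apply: contraTT l2 => aA; rewrite -ltnNge.
have := hmin (a - j.+1); have -> : j + (a - j.+1).+1 = a by lia.
by move/(_ aA); lia.
Qed.

Lemma rightmost_exists_below n p (b : nat -> bool) j : is_ncp n p -> j <= n.+1 ->
  (forall A, A \in p -> exists2 a, a \in A & a <= j) ->
  exists w, [/\ rightmost w, wdeg w = n, wbelow j.+1 w, (weval w).1 = p &
     forall l, l < j -> nth false (weval w).2 l = b l].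
Proof.
elim: j n p => [|j IH] n p hp hj hA.
  have p0 : p = fset0.
    apply/fsetP => A; rewrite inE; apply/negP => Ap.
    have [a aA a0] := hA _ Ap.
    by have /is_ncpP[_ /(_ _ _ Ap aA)] := hp; lia.
  have n0 : n = 0.
    case: n hp hj => // n /is_ncpP[_ _ /(_ 1 isT)[A]]; by rewrite p0 inE.
  by exists [::]; rewrite p0 n0.
have [hAj|] := boolP (all (fun A : {fset nat} => has (fun a => a <= j) A) p).
  have hA' (A : {fset nat}) : A \in p -> exists2 a, a \in A & a <= j.
    by move=> Ap; have /hasP[a aA aj] := allP hAj _ Ap; exists a.
  have [w [wr wd wb wp wn]] := IH n p hp (ltnW hj) hA'.
  have [e|ne] := eqVneq (nth false (weval w).2 j) (b j).
    exists w; split=> //; first exact: wbelow_mono wb.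
    by move=> l; rewrite ltnS leq_eqVlt => /orP[/eqP->|/wn].
  have wr' : rightmost ((j.+1, 0, true) :: w) by rewrite /= wr wb wd; lia.
  exists ((j.+1, 0, true) :: w); split=> //.
  - by rewrite /= wd addn0.
  - by rewrite /= /fpos /= ltnSn (wbelow_mono _ wb).
  - by rewrite (weval_comp1 wr') comp_part0.
  - move=> l lj; rewrite (nth_weval _ wr') /= addn0 ltnS -ltnS.
    case: ltnP => h; first exact: wn.
    have -> : l = j by lia.
    rewrite leqnn eqxx /=; by move: ne; case: nth; case: (b j).
case/allPn => A Ap /hasPn Aj.
have {}Aj a : a \in A -> j < a by move/Aj; rewrite ltnNge.
have jA : j.+1 \in A.
  have [a aA] := hA _ Ap; rewrite leq_eqVlt => /orP[/eqP <- //|].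
  by have := Aj _ aA; lia.
have [m m0 Am] := block_gap hp Ap Aj jA hA.
have /is_ncpP[pne prg pcov pdj pnc] := hp.
have hn : j + m <= n.
  have h : j + m \in A by rewrite Am; lia.
  by have := prg _ _ Ap h; lia.
have mn : n - m + m = n by clear -hn; lia.
have hjm : j <= n - m by clear -hn; lia.
pose un x := if x <= j then x else x - m.
have unK (B : {fset nat}) x : B \in p -> B != A -> x \in B -> shift j.+1 m (un x) = x.
  move=> Bp nB xB; rewrite /shift /un.
  case: (leqP x j) => [h|h]; first by rewrite ltnS h.
  have [h2|h2] := leqP x (j + m).
    have xA : x \in A by rewrite Am h.
    by rewrite (pdj B A x) ?eqxx in nB.
  by case: ltnP; lia.
pose p' := [fset [fset un x | x in (B : {fset nat})] | B : {fset nat} in p `\ A].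
have mem_p' B' : reflect (exists2 B : {fset nat}, B \in p /\ B != A & B' = [fset un x | x in B]) (B' \in p').
  apply: (iffP (imfsetP _ _ _ _)) => -[B].
    by rewrite !inE => /andP[? ?] ->; exists B.
  by case=> ? ? ->; exists B; rewrite // !inE; apply/andP.
have in_un (B : {fset nat}) y : reflect (exists2 x, x \in B & y = un x) (y \in [fset un x | x in B]).
  by apply: (iffP (imfsetP _ _ _ _)) => -[x xA ->]; exists x.
have unS (B : {fset nat}) : B \in p -> B != A -> (shift j.+1 m @` [fset un x | x in B])%fset = B.
  move=> Bp nB; apply/fsetP => x; apply/in_shift/idP => [[y /in_un[z zB ->] ->]|xB].
    by rewrite (unK B).
  exists (un x); last by rewrite (unK B).
  by apply/in_un; exists x.
have hp' : is_ncp (n - m) p'.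
  apply/is_ncpP; split.
  - move=> B' /mem_p'[B [Bp nB] ->]; have [x xB] := pne _ Bp.
    by exists (un x); apply/in_un; exists x.
  - move=> B' a /mem_p'[B [Bp nB] ->] /in_un[x xB ->].
    have := prg _ _ Bp xB; have := unK _ _ Bp nB xB; rewrite /un /shift.
    by case: (leqP x j) => h; [lia|case: ltnP; lia].
  - move=> a ha.
    have hs : 1 <= shift j.+1 m a <= n by rewrite /shift; case: (ltnP a j.+1); lia.
    have [B Bp aB] := pcov _ hs.
    have nB : B != A.
      apply: contraTneq aB => ->; rewrite Am /shift; case: (ltnP a j.+1); lia.
    exists [fset un x | x in B]; first by apply/mem_p'; exists B.
    apply/in_un; exists (shift j.+1 m a) => //.
    by apply: (@shift_inj j.+1 m); rewrite (unK B).
  - move=> B' C' a /mem_p'[B [Bp nB] ->] /mem_p'[C [Cp nC] ->] /in_un[x xB ->] /in_un[y yC e].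
    have exy : x = y by rewrite -(unK _ _ Bp nB xB) e (unK _ _ Cp nC yC).
    by rewrite (pdj B C x) // exy.
  - move=> B' C' /mem_p'[B [Bp nB] ->] /mem_p'[C [Cp nC] ->] a a' b1 b'
      /in_un[x xB ->] /in_un[x' x'B ->] /in_un[y yC ->] /in_un[y' y'C ->].
    rewrite -(shift_ltE j.+1 m (un x)) -(shift_ltE j.+1 m (un y)) -(shift_ltE j.+1 m (un x')).
    rewrite (unK _ _ Bp nB xB) (unK _ _ Bp nB x'B).
    rewrite (unK _ _ Cp nC yC) (unK _ _ Cp nC y'C) => l1 l2 l3.
    by rewrite (pnc B C Bp Cp x x' y y').
have hA' (B' : {fset nat}) : B' \in p' -> exists2 a, a \in B' & a <= j.
  move=> /mem_p'[B [Bp nB] ->]; have [x xB xj] := hA _ Bp.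
  have xj' : x <= j.
    move: xj; rewrite leq_eqVlt => /orP[/eqP ex|//].
    by rewrite (pdj B A x) ?eqxx // ?ex // in nB.
  by exists x => //; apply/in_un; exists x; rewrite // /un xj'.
have [|w [wr wd wb wp wn]] := IH (n - m) p' hp' _ hA'; first lia.
set c := nth false (weval w).2 j (+) b j.
have wr' : rightmost ((j.+1, m, c) :: w) by rewrite /= wr wb wd m0 !ltnS hjm.
exists ((j.+1, m, c) :: w); split=> //.
- by rewrite /= wd.
- by rewrite /= /fpos /= ltnSn (wbelow_mono _ wb).
- rewrite (weval_comp1 wr') wp; apply/fsetP => B.
  have fA : (shift 1 j @` full m)%fset = A.
    by apply/fsetP => x; rewrite Am; have /= -> := @in_shift_full j.+1 m x isT.
  apply/mem_comp_part/idP => [[[B' /mem_p'[C [Cp nC] ->] ->]|[B']]|Bp].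
  + by rewrite unS.
  + by rewrite /raw_psi /= -[m == 0]negbK -lt0n m0 /= => /fset1P -> ->; rewrite fA.
  + have [->|nB] := eqVneq B A; last first.
      left; exists [fset un x | x in B]; last by rewrite unS.
      by apply/mem_p'; exists B.
    right; exists (full m); last by rewrite fA.
    by rewrite /raw_psi /= -[m == 0]negbK -lt0n m0 /= fset11.
- move=> l lj; rewrite (nth_weval _ wr') /=.
  case: ltnP => h; first exact: wn.
  have -> : l = j by lia.
  have -> : j < j.+1 + m by lia.
  by rewrite eqxx /= /c addbA addbb.
Qed.

Lemma rightmost_exists n x : is_pncp n x ->
  exists w, [/\ rightmost w, wdeg w = n & weval w = x].
Proof.
case: x => p b /andP[/= hp /eqP hb].
have [|w [wr wd _ wp wn]] :=
  @rightmost_exists_below n p (nth false b) n.+1 hp (leqnn _).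
  move=> A Ap; have /is_ncpP[/(_ _ Ap)[a aA] /(_ _ _ Ap aA) h _ _ _] := hp.
  by exists a => //; lia.
exists w; split=> //; rewrite -wp [LHS]surjective_pairing; congr pair.
have sw := size_weval wr.
apply: (@eq_from_nth _ false); first by rewrite sw wd hb.
by move=> l; rewrite sw wd => /wn.
Qed.

Lemma comp_block i m c w (A : {fset nat}) : rightmost ((i, m, c) :: w) ->
  A \in (weval ((i, m, c) :: w)).1 -> (forall a, a \in A -> i <= a) ->
  0 < m /\ forall a, (a \in A) = (i <= a < i + m).
Proof.
move=> wr; rewrite (weval_comp1 wr); case/and4P: wr => hi hmc hb hr.
case/mem_comp_part => [[B Bp ->]|[B]].
  have [b bB bi] := wbelow_block hr hb Bp.
  have /[swap]/[apply] : shift i m b \in (shift i m @` B)%fset by apply/in_shift; exists b.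
  by rewrite /shift bi; lia.
rewrite /raw_psi /=; case: m {hmc} => [|m] /=; first by rewrite inE.
move=> /fset1P -> -> _; split=> // a; rewrite in_shift_full //; lia.
Qed.

Lemma comp_block_in i m c w : rightmost ((i, m, c) :: w) -> 0 < m ->
  exists2 A, A \in (weval ((i, m, c) :: w)).1 &
    forall a, (a \in A) = (i <= a < i + m).
Proof.
move=> wr m0; have /and4P[hi hmc hb hr] := wr.
exists (shift 1 i.-1 @` full m)%fset.
  rewrite (weval_comp1 wr).
  apply/mem_comp_part; right; exists (full m) => //.
  by rewrite /raw_psi /= -[m == 0]negbK -lt0n m0 /= fset11.
by move=> a; rewrite in_shift_full //; lia.
Qed.

Lemma comp_part_psi_inj i m c w1 w2 : rightmost w1 -> rightmost w2 ->
  0 < i -> wbelow i w1 -> wbelow i w2 ->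
  comp_part i m (weval w1).1 (raw_psi m c).1 =
  comp_part i m (weval w2).1 (raw_psi m c).1 -> (weval w1).1 = (weval w2).1.
Proof.
move=> r1 r2 i0.
suff H u v : rightmost u -> wbelow i u ->
  comp_part i m (weval u).1 (raw_psi m c).1 =
  comp_part i m (weval v).1 (raw_psi m c).1 ->
  forall A, A \in (weval u).1 -> A \in (weval v).1.
  by move=> b1 b2 e; apply/fsetP => A; apply/idP/idP; apply: H.
move=> ru bu e A Au.
have : (shift i m @` A)%fset \in comp_part i m (weval u).1 (raw_psi m c).1.
  by apply/mem_comp_part; left; exists A.
rewrite e => /mem_comp_part[[B Bp /shift_img_inj ->//]|[B]].
rewrite /raw_psi /=; case: m {e} => [|m]; rewrite /= ?inE // => /eqP -> eA.
have [a aA ai] := wbelow_block ru bu Au.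
have : shift i m.+1 a \in (shift 1 i.-1 @` full m.+1)%fset.
  by rewrite -eA; apply/in_shift; exists a.
by rewrite in_shift_full // /shift ai; lia.
Qed.

Definition agree j (w1 w2 : seq factor) : Prop :=
  [/\ wdeg w1 = wdeg w2, (weval w1).1 = (weval w2).1 & forall k, k < j.-1 ->
    nth false (weval w1).2 k = nth false (weval w2).2 k].

Lemma agree_sym j w1 w2 : agree j w1 w2 -> agree j w2 w1.
Proof. by case=> h1 h2 h3; split=> // k /h3. Qed.

Lemma uniq_step j i l e w1 w2 : rightmost w1 -> rightmost ((i, l, e) :: w2) ->
  wbelow i w1 -> i < j -> agree j w1 ((i, l, e) :: w2) ->
  (agree i w1 w2 -> w1 = w2) -> False.
Proof.
move=> r1 r2 b1 ij [hd hp hn] H; have /and4P[hi hl b2 r2'] := r2.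
have [l0|l0] := posnP l; last first.
  have [A + hA] := comp_block_in r2 l0; rewrite -hp => Ap.
  by have [a] := wbelow_block r1 b1 Ap; rewrite hA; lia.
move: l0 => l0; subst l; have e1 : e = true by []. subst e.
have /H e12 : agree i w1 w2.
  split; first by rewrite hd /= addn0.
    by rewrite hp (weval_comp1 r2) /= comp_part0.
  move=> k hk; have /hn-> : k < j.-1 by lia.
  by rewrite (nth_weval _ r2) hk.
have := hn i.-1; rewrite (nth_weval _ r2) ltnn.
have -> : i.-1 < i + 0 by lia.
rewrite e12 eqxx /= => /(_ _)/eqP; case: nth => /=; move=> h;
by have : false by (apply: h; lia).
Qed.

Lemma rightmost_uniq_below N j w1 w2 : size w1 + size w2 <= N ->
  rightmost w1 -> rightmost w2 -> wbelow j w1 -> wbelow j w2 ->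
  agree j w1 w2 -> w1 = w2.
Proof.
elim: N j w1 w2 => [|N IH] j w1 w2; first by case: w1; case: w2.
case: w1 => [|[[i m] c] w1]; case: w2 => [|[[i2 l] e] w2] //.
- move=> hs r1 r2 b1 /andP[/= b b2] ag; exfalso.
  have /and4P[_ _ h2 r2'] := r2.
  by apply: (uniq_step r1 r2 _ b ag) => // ag'; apply: (IH i2).
- move=> hs r1 r2 /andP[/= b b1] b2 ag; exfalso.
  have /and4P[_ _ h1 r1'] := r1.
  apply: (uniq_step r2 r1 _ b (agree_sym ag)) => // ag'; apply: (IH i) => //.
  by move: hs; rewrite /= addn0.
move=> hs r1 r2 /andP[/= b b1] /andP[/= b' b2] ag.
have /and4P[hi1 _ h1 r1'] := r1; have /and4P[hi2 _ h2 r2'] := r2.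
rewrite /fpos /= in b b' hs.
have [lt|gt|ei] := ltngtP i i2.
- exfalso.
  have bw : wbelow i2 ((i, m, c) :: w1).
    by rewrite /= {1}/fpos lt (wbelow_mono _ h1) // ltnW.
  apply: (uniq_step r1 r2 bw b' ag) => ag'; apply: (IH i2) => //=; lia.
- exfalso.
  have bw : wbelow i ((i2, l, e) :: w2).
    by rewrite /= {1}/fpos gt (wbelow_mono _ h2) // ltnW.
  apply: (uniq_step r2 r1 bw b (agree_sym ag)) => ag'; apply: (IH i) => //=; lia.
subst i2; case: ag => hd hp hn.
have eml : m = l.
  have [m0|m0] := posnP m; have [l0|l0] := posnP l.
  - by rewrite m0 l0.
  - have [A Ap hA] := comp_block_in r2 l0; rewrite -hp in Ap.
    have [|//] := comp_block r1 Ap; last by rewrite m0.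
    by move=> a; rewrite hA => /andP[].
  - have [A Ap hA] := comp_block_in r1 m0; rewrite hp in Ap.
    have [|//] := comp_block r2 Ap; last by rewrite l0.
    by move=> a; rewrite hA => /andP[].
  - have [A Ap hA] := comp_block_in r1 m0; rewrite hp in Ap.
    have [|_ hA'] := comp_block r2 Ap; first by move=> a; rewrite hA => /andP[].
    have := hA (i + m).-1; have := hA (i + l).-1; rewrite !hA'; lia.
subst l.
have ew : w1 = w2.
  apply: (IH i) => //; first lia.
  split; first by move: hd => /= /addIn.
    move: hp; rewrite (weval_comp1 r1) (weval_comp1 r2).
    by apply: (@comp_part_psi_inj i m c) => //; lia.
  move=> k hk; have := hn k; rewrite (nth_weval _ r1) (nth_weval _ r2) hk; apply; lia.
subst w2; congr (_ :: _); congr pair.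
have := hn i.-1; rewrite (nth_weval _ r1) (nth_weval _ r2) ltnn eqxx /=.
have -> : i.-1 < i + m by lia.
by move=> h; apply: (@addbI (nth false (weval w1).2 i.-1)); apply: h; lia.
Qed.

Lemma rightmost_uniq w1 w2 : rightmost w1 -> rightmost w2 ->
  weval w1 = weval w2 -> w1 = w2.
Proof.
move=> r1 r2 e.
have hd : wdeg w1 = wdeg w2.
  by apply/eqP; rewrite -eqSS -(size_weval r1) -(size_weval r2) e.
apply: (@rightmost_uniq_below _ (wdeg w1).+2 _ _ (leqnn _)) => //.
- exact: rightmost_wbelow.
- by rewrite hd; apply: rightmost_wbelow.
- by split; rewrite ?e.
Qed.

Definition pncp (n : nat) : choiceType := {x : raw_pncp | is_pncp n x}.

Lemma rdec_subproof n (x : pncp n) :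
  exists w, rightmost w && (weval w == val x).
Proof.
by have [w [wr _ we]] := rightmost_exists (valP x); exists w; rewrite wr we eqxx.
Qed.

Definition rdec n (x : pncp n) : seq factor := xchoose (rdec_subproof x).

Lemma rdecP n (x : pncp n) : rightmost (rdec x) /\ weval (rdec x) = val x.
Proof. by have /andP[? /eqP ?] := xchooseP (rdec_subproof x). Qed.

Lemma rdec_uniq n (x : pncp n) w :
  rightmost w -> weval w = val x -> rdec x = w.
Proof.
by move=> wr we; have [r e] := rdecP x; apply: rightmost_uniq; rewrite // we e.
Qed.

Lemma wdeg_rdec n (x : pncp n) : wdeg (rdec x) = n.
Proof.
have [r e] := rdecP x; apply/eqP; rewrite -eqSS -(size_weval r) e.
by have /andP[_] := valP x.
Qed.

Definition psi (n : nat) (c : bool) : pncp n :=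
  exist _ (raw_psi n c) (raw_psi_pncp n c).

(* x o_i y in NCP_F2(r).  To avoid casts along n + m = r the target degree is an
   argument; the default value is returned only when r <> n + m or i is not in
   [1, n + 1], see [val_pcomp]. *)
Definition pcomp (r i : nat) n m (x : pncp n) (y : pncp m) : pncp r :=
  insubd (psi r false) (raw_comp i (val x) (val y)).

Lemma val_pcomp i n m (x : pncp n) (y : pncp m) : 1 <= i <= n.+1 ->
  val (pcomp (n + m) i x y) = raw_comp i (val x) (val y).
Proof.
move=> hi; rewrite val_insubd (raw_comp_pncp hi) //; exact: valP.
Qed.

Variant endpoint := pt_s | pt_t.

Definition is_pt_t (e : endpoint) : bool := if e is pt_t then true else false.
Definition endpoint_of (b : bool) : endpoint := if b then pt_t else pt_s.
Lemma is_pt_tK : cancel is_pt_t endpoint_of. Proof. by case. Qed.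
HB.instance Definition _ := Choice.copy endpoint (can_type is_pt_tK).

Definition cell (n : nat) : choiceType := if n is m.+1 then pncp m else endpoint.

(* {freeg K} is the free abelian group on K; [gen x] is the generator x. *)
Definition E (n : nat) : lmodType int := {freeg (cell n)}.

Definition gen n (x : cell n) : E n := << x >>.

(* The homomorphism given on generators by [f]. *)
Definition extend n (M : lmodType int) (f : cell n -> M) (u : E n) : M := fglift f u.

(* E_(n+1) is free on NCP_F2(n), hence the shift; o_i is not defined on E_0, and
   is 0 there by convention. *)
Definition cell_comp (c i : nat) a b : cell a -> cell b -> E c :=
  match a, b, c return cell a -> cell b -> E c with
  | a'.+1, b'.+1, c'.+1 => fun x y => gen (pcomp c' i x y : cell c'.+1)
  | _, _, _ => fun _ _ => 0%R
  end.

Definition ecomp (c i : nat) a b (u : E a) (v : E b) : E c :=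
  extend (fun x => extend (cell_comp c i x) v) u.

Definition psiE (n : nat) (c : bool) : E n.+1 := gen (psi n c : cell n.+1).

Local Open Scope ring_scope.

(* d psi_n^c, in E_n *)
Definition dpsi (n : nat) (c : bool) : E n :=
  match n return E n with
  | 0 => (-1) ^+ c *: (gen (pt_t : cell 0) - gen (pt_s : cell 0))
  | m.+1 => psiE m (~~ c) + (-1) ^+ m *: psiE m c
  end.

(* The polarised partition denoted by the word [w], of degree [n]. *)
Definition wcell (w : seq factor) (n : nat) : pncp n :=
  insubd (psi n false) (weval w).

Definition wgen (w : seq factor) (n : nat) : E n.+1 := gen (wcell w n : cell n.+1).

(* d of the generator of degree [n] whose rightmost decomposition is [w], by
   induction on the length of [w].  For a last factor psi_m^c with m > 0, the
   element p' = [wgen w' k] of the recursive clause has degree k = n - m; for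
   m = 0 it has degree k = n. *)
Fixpoint dword (w : seq factor) (n : nat) {struct w} : E n :=
  match w with
  | [::] => dpsi n false
  | (i, m, c) :: w' =>
    if nilp w' then dpsi n c else
    match m with
    | 0 => if i == n.+1 then - dword w' n
           else ecomp n i (dword w' n) (psiE 0 true)
    | _ => let k := (n - m)%N in
           if i == k.+1 then ecomp n i (wgen w' k) (dpsi m c)
           else ecomp n i (dword w' k) (psiE m c)
                + (-1) ^+ (k.+1 - i) *: ecomp n i (wgen w' k) (dpsi m c)
    end
  end.

Definition dE (n : nat) : E n.+1 -> E n :=
  extend (fun x : cell n.+1 => dword (rdec x) n).

Definition eE : E 0 -> int := extend (fun _ : cell 0 => 1 : int^o).

Definition tau_bits (b : bitseq) : bitseq :=
  if b is b1 :: b' then (b1 (+) true) :: b' else [::].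

Definition raw_tau (x : raw_pncp) : raw_pncp := (x.1, tau_bits x.2).

Lemma raw_tau_pncp n (x : pncp n) : is_pncp n (raw_tau (val x)).
Proof. by have := valP x; case: (val x) => p [|b1 b]. Qed.

Definition tau_cell (n : nat) : cell n -> cell n :=
  match n return cell n -> cell n with
  | 0 => fun e => if e is pt_s then pt_t else pt_s
  | m.+1 => fun x => exist _ (raw_tau (val x)) (raw_tau_pncp x)
  end.

Definition tau (n : nat) : E n -> E n := extend (fun x => gen (tau_cell x)).

Lemma extend_gen n (M : lmodType int) (f : cell n -> M) x : extend f (gen x) = f x.
Proof. by rewrite /extend /gen liftU scale1r. Qed.

Lemma extend_is_additive n (M : lmodType int) (f : cell n -> M) :
  zmod_morphism (extend f).
Proof. exact: lift_is_additive. Qed.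

HB.instance Definition _ n (M : lmodType int) (f : cell n -> M) :=
  GRing.isZmodMorphism.Build (E n) M (extend f) (extend_is_additive f).

Lemma extendZ n (M : lmodType int) (f : cell n -> M) a u :
  extend f (a *: u) = a *: extend f u.
Proof. by rewrite -[a]intz !scaler_int raddfMz. Qed.

Lemma E_ind n (P : E n -> Prop) : P 0 ->
  (forall a x v, P v -> P (a *: gen x + v)) -> forall v, P v.
Proof.
move=> P0 PD v; rewrite -[v]freeg_sumE.
elim/big_rec: _ => // x u _ Pu.
suff -> : << coeff x v *g x >> = coeff x v *: gen x :> E n by exact: PD.
by apply/eqP/freeg_eqP => y; rewrite coeffZ !coeffU mul1r.
Qed.

Lemma extend_eq n (M : lmodType int) (f : cell n -> M) (g : E n -> M) :
  zmod_morphism g -> (forall x, f x = g (gen x)) -> forall u, extend f u = g u.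
Proof.
move=> ga fg.
pose g' : {additive E n -> M} := HB.pack g (GRing.isZmodMorphism.Build _ _ g ga).
have gE : g =1 g' by [].
elim/E_ind => [|a x v IH]; first by rewrite gE !raddf0.
rewrite raddfD /= extendZ extend_gen fg IH !gE raddfD; congr (_ + _).
by rewrite -[a]intz !scaler_int raddfMz.
Qed.

Section Comp.
Variables (c i a b : nat).
Implicit Types (u : E a) (v : E b).

Lemma ecompDl u1 u2 v : ecomp c i (u1 + u2) v = ecomp c i u1 v + ecomp c i u2 v.
Proof. exact: raddfD. Qed.
Lemma ecompNl u v : ecomp c i (- u) v = - ecomp c i u v.
Proof. exact: raddfN. Qed.
Lemma ecomp0l v : ecomp c i (0 : E a) v = 0.
Proof. exact: raddf0. Qed.
Lemma ecompZl k u v : ecomp c i (k *: u) v = k *: ecomp c i u v.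
Proof. exact: extendZ. Qed.
Lemma ecomp_gen (x : cell a) (y : cell b) :
  ecomp c i (gen x) (gen y) = cell_comp c i x y.
Proof. by rewrite /ecomp !extend_gen. Qed.
Lemma ecompDr u v1 v2 : ecomp c i u (v1 + v2) = ecomp c i u v1 + ecomp c i u v2.
Proof.
elim/E_ind: u => [|k x u IH]; first by rewrite !ecomp0l addr0.
rewrite !ecompDl !ecompZl IH /ecomp !extend_gen raddfD scalerDr.
by rewrite addrACA.
Qed.
Lemma ecompZr k u v : ecomp c i u (k *: v) = k *: ecomp c i u v.
Proof.
elim/E_ind: u => [|l x u IH]; first by rewrite !ecomp0l scaler0.
rewrite !ecompDl !ecompZl IH /ecomp !extend_gen extendZ scalerDr.
by rewrite scalerA mulrC -scalerA.
Qed.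
Lemma ecomp0r u : ecomp c i u (0 : E b) = 0.
Proof. by rewrite -(scale0r (0 : E b)) ecompZr scale0r. Qed.
End Comp.

Lemma raw_comp_unitl m c : raw_comp 1 (raw_psi 0 false) (raw_psi m c) = raw_psi m c.
Proof.
rewrite /raw_comp [(raw_psi 0 false).1]/= [(raw_psi 0 false).2]/=.
have s0 (A : {fset nat}) : (shift 1 0 @` A)%fset = A.
  apply/fsetP => a; apply/in_shift/idP => [[x xA ->]|aA].
    by rewrite /shift addn0 if_same.
  by exists a => //; rewrite /shift addn0 if_same.
rewrite [RHS]surjective_pairing; congr pair.
  apply/fsetP => A; apply/mem_comp_part/idP => [[[B]|[B Bp ->]]|Ap].
  - by rewrite inE.
  - by rewrite s0.
  - by right; exists A; rewrite ?s0.
by rewrite /comp_bits /= cats0; congr cons; apply: map_id.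
Qed.

Lemma weval_single m c : weval [:: (1%N, m, c)] = raw_psi m c.
Proof. exact: raw_comp_unitl. Qed.

Lemma wcell_rightmost w n : rightmost w -> wdeg w = n -> val (wcell w n) = weval w.
Proof.
by move=> wr wd; rewrite val_insubd -{1}wd weval_pncp.
Qed.

Lemma rdec_wcell w n : rightmost w -> wdeg w = n -> rdec (wcell w n) = w.
Proof. by move=> wr wd; apply: rdec_uniq => //; rewrite wcell_rightmost. Qed.

Lemma wcell_rdec n (x : pncp n) : wcell (rdec x) n = x.
Proof.
apply: val_inj; have [r e] := rdecP x.
by rewrite wcell_rightmost // wdeg_rdec.
Qed.

HB.instance Definition _ n := GRing.isZmodMorphism.Build (E n.+1) (E n) (@dE n)
  (extend_is_additive (fun x : cell n.+1 => dword (rdec x) n)).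

HB.instance Definition _ := GRing.isZmodMorphism.Build (E 0) int eE
  (extend_is_additive (fun _ : cell 0 => 1 : int^o)).

HB.instance Definition _ n := GRing.isZmodMorphism.Build (E n) (E n) (@tau n)
  (extend_is_additive (fun x => gen (tau_cell x))).

Lemma dEZ n a (u : E n.+1) : dE (a *: u) = a *: dE u.
Proof. exact: extendZ. Qed.

Lemma eEZ a (u : E 0) : eE (a *: u) = a * eE u.
Proof. exact: (extendZ (fun _ : cell 0 => 1 : int^o) a u). Qed.

Lemma dE_gen n (x : pncp n) : dE (gen (x : cell n.+1)) = dword (rdec x) n.
Proof. exact: extend_gen. Qed.

Lemma dE_wgen w n : rightmost w -> wdeg w = n -> dE (wgen w n) = dword w n.
Proof. by move=> wr wd; rewrite dE_gen rdec_wcell. Qed.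

Definition wsnoc (w : seq factor) (f : factor) :=
  if (f.1.2 == 0)%N && ~~ f.2 then w else f :: w.

Lemma wsnocP w i m c k : rightmost w -> wdeg w = k -> wbelow i w ->
  (1 <= i <= k.+1)%N ->
  [/\ rightmost (wsnoc w (i, m, c)), wdeg (wsnoc w (i, m, c)) = (k + m)%N,
     wbelow i.+1 (wsnoc w (i, m, c)) &
     weval (wsnoc w (i, m, c)) = raw_comp i (weval w) (raw_psi m c)].
Proof.
move=> wr wd wb hi; rewrite /wsnoc /=; case: ifP => [/andP[/eqP-> /negPf->]|hmc].
  split=> //; first by rewrite addn0.
    exact: wbelow_mono wb.
  by rewrite (@raw_comp_unit k) // -wd weval_pncp.
split=> //=.
- by rewrite wd hi wb wr; move: hmc; case: m => //=; case: c.
- by rewrite wd.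
- by rewrite /fpos /= ltnSn (wbelow_mono _ wb).
Qed.

Lemma wgen_wsnoc w i m c k n : rightmost w -> wdeg w = k -> wbelow i w ->
  (1 <= i <= k.+1)%N -> n = (k + m)%N ->
  ecomp n.+1 i (wgen w k) (psiE m c) = wgen (wsnoc w (i, m, c)) n.
Proof.
move=> wr wd wb hi ->; rewrite ecomp_gen /= /wgen; congr (@gen _.+1 _); apply: val_inj.
have [r d _ e] := wsnocP m c wr wd wb hi.
by rewrite wcell_rightmost // e val_pcomp // wcell_rightmost.
Qed.

Lemma psiE_word n c : exists w,
  [/\ rightmost w, wdeg w = n, wbelow 2 w & psiE n c = wgen w n].
Proof.
have [r d b e] := wsnocP n c (erefl (rightmost [::])) (erefl _) (erefl (wbelow 1 [::])) isT.
exists (wsnoc [::] (1%N, n, c)); split=> //.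
rewrite /psiE /wgen; congr (@gen _.+1 _); apply: val_inj.
by rewrite wcell_rightmost //= e raw_comp_unitl.
Qed.

(* The span of the generators whose rightmost decomposition uses only positions
   below [i]. *)
Inductive inS i n : E n.+1 -> Prop :=
 | inS0 : inS i 0
 | inSD a w v : rightmost w -> wdeg w = n -> wbelow i w -> inS i v ->
     inS i (a *: wgen w n + v).

Lemma inS_add i n (u v : E n.+1) : inS i u -> inS i v -> inS i (u + v).
Proof.
elim => [|a w u' wr wd wb _ IH] hv; first by rewrite add0r.
by rewrite -addrA; apply: inSD => //; apply: IH.
Qed.

Lemma inS_scale i n k (u : E n.+1) : inS i u -> inS i (k *: u).
Proof.
elim => [|a w u' wr wd wb _ IH]; first by rewrite scaler0; apply: inS0.
by rewrite scalerDr scalerA; apply: inSD.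
Qed.

Lemma inS_wgen i n w : rightmost w -> wdeg w = n -> wbelow i w -> inS i (wgen w n).
Proof.
by move=> *; rewrite -[wgen _ _]addr0 -[wgen _ _]scale1r; apply: inSD => //; apply: inS0.
Qed.

Lemma inS_opp i n (u : E n.+1) : inS i u -> inS i (- u).
Proof. by rewrite -scaleN1r; apply: inS_scale. Qed.

Lemma inS_dpsi n c i : (2 <= i)%N -> inS i (dpsi n.+1 c).
Proof.
have h d : (2 <= i)%N -> inS i (psiE n d).
  move=> hi; have [w [wr wd wb ->]] := psiE_word n d.
  by apply: inS_wgen => //; exact: wbelow_mono wb.
by move=> hi; apply: inS_add; [|apply: inS_scale]; exact: h.
Qed.

Lemma inS_comp i j n k m (c : bool) (v : E k.+1) : inS j v -> (1 <= j <= k.+1)%N ->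
  (j < i)%N -> n = (k + m)%N -> inS i (ecomp n.+1 j v (psiE m c)).
Proof.
move=> hv hj ji hn; elim: hv => [|a w u wr wd wb _ IH].
  by rewrite ecomp0l; apply: inS0.
rewrite ecompDl ecompZl (wgen_wsnoc c wr wd wb hj hn).
apply: inS_add => //; apply: inS_scale.
have [r d b e] := wsnocP m c wr wd wb hj.
apply: inS_wgen => //; [by rewrite d|exact: wbelow_mono b].
Qed.

Lemma inS_comp_dpsi i j n k m (c : bool) (v : E k.+1) : inS j v -> (1 <= j <= k.+1)%N ->
  (j < i)%N -> n = (k + m)%N -> inS i (ecomp n.+1 j v (dpsi m.+1 c)).
Proof.
move=> hv hj ji hn; rewrite ecompDr ecompZr; apply: inS_add; [|apply: inS_scale];
exact: inS_comp.
Qed.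

Lemma rightmost_deg i m c w : rightmost ((i, m, c) :: w) -> ~~ nilp w ->
  (2 <= i)%N /\ (1 <= wdeg w)%N.
Proof.
case: w => // -[[j l] e] w /= /and4P[h1 _ /andP[+ _] /and4P[h2 _ _ _]] _.
by rewrite /fpos /=; move: h1 h2; lia.
Qed.

Lemma rightmost_single i m c : rightmost [:: (i, m, c)] -> i = 1%N.
Proof. by move=> /= /andP[h _]; lia. Qed.

Lemma dword_inS w n i : rightmost w -> wdeg w = n.+1 -> wbelow i w ->
  inS i (dword w n.+1).
Proof.
elim: w n i => [//|[[j m] c] w IH] n i wr wd /andP[ji _].
rewrite /fpos /= in ji; have /and4P[hj hmc hb hr] := wr.
have [nw|nw] := boolP (nilp w).
  rewrite /= nw; apply: inS_dpsi.
  by case: w nw wr {IH wd hj hb hr} => // _ /rightmost_single; lia.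
have [j2 k1] := rightmost_deg wr nw.
move: wd; rewrite /= (negPf nw); set k := wdeg w in hj k1 *.
case: m hmc {wr} => [_|m _] hk.
  have ek : wdeg w = n.+1 by rewrite -hk addn0.
  case: ifP => e; first by apply: inS_opp; apply: IH => //; apply: wbelow_mono hb; lia.
  apply: (@inS_comp i j n n 0 true); [exact: IH|lia|lia|lia].
have ek : (n.+1 - m.+1)%N = k by lia.
rewrite ek.
have hp : inS j (wgen w k) by apply: inS_wgen.
case: ifP => e.
  apply: inS_comp_dpsi; [exact: hp|lia|lia|lia].
apply: inS_add; last first.
  apply: inS_scale; apply: inS_comp_dpsi; [exact: hp|lia|lia|lia].
case ek' : k k1 => [//|k'] _.
apply: (@inS_comp i j n k' m.+1 c); [exact: IH|lia|lia|lia].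
Qed.

Lemma dpsi2 n c : dpsi n (~~ c) + (-1) ^+ n *: dpsi n c = 0.
Proof.
case: n => [|n] /=.
  by rewrite expr0 scale1r -scalerDl; case: c => /=; rewrite ?expr0 ?expr1 ?subrr ?addNr scale0r.
rewrite negbK exprS mulN1r scaleNr scalerDr scalerA -expr2 sqrr_sign scale1r.
by rewrite [X in _ - X]addrC subrr.
Qed.

Section Leibniz.
Variables (j k : nat) (hj2 : (2 <= j)%N).

Lemma word_not_nil w : wdeg w = k.+1 -> nilp w = false.
Proof. by case: w. Qed.

Lemma leib0_last c v : j = k.+2 -> inS j v ->
  dE (ecomp k.+2 j v (psiE 0 c)) = (-1) ^+ c *: dE (v : E k.+2).
Proof.
move=> ej hv; elim: hv => [|a w u wr wd wb _ IH].
  by rewrite ecomp0l !raddf0.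
rewrite ecompDl ecompZl !raddfD /= IH; congr (_ + _).
rewrite !dEZ scalerA mulrC -scalerA; congr (_ *: _).
rewrite (@wgen_wsnoc w j 0 c k.+1 k.+1) //; try lia.
have [|r d b e] := wsnocP 0 c wr wd wb; first by lia.
rewrite (dE_wgen wr wd) dE_wgen //; last by rewrite d addn0.
rewrite /wsnoc; case: (c) => /=; last by rewrite expr0 scale1r.
by rewrite word_not_nil // ej eqxx expr1 scaleN1r.
Qed.

Lemma leib0 c v : (j <= k.+1)%N -> inS j v ->
  dE (ecomp k.+2 j v (psiE 0 c)) = ecomp k.+1 j (dE (v : E k.+2)) (psiE 0 c).
Proof.
move=> ej hv; elim: hv => [|a w u wr wd wb _ IH].
  by rewrite ecomp0l !raddf0 ecomp0l.
rewrite ecompDl ecompZl !raddfD /= IH ecompDl; congr (_ + _).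
rewrite !dEZ ecompZl; congr (_ *: _).
rewrite (@wgen_wsnoc w j 0 c k.+1 k.+1) //; try lia.
have [|r d b e] := wsnocP 0 c wr wd wb; first by lia.
rewrite (dE_wgen wr wd) dE_wgen //; last by rewrite d addn0.
rewrite /wsnoc; case: (c) => /=.
  by rewrite word_not_nil //; case: eqP => // h; exfalso; lia.
have := dword_inS wr wd wb; elim => [|a' w' u' wr' wd' wb' _ IH'].
  by rewrite ecomp0l.
rewrite ecompDl ecompZl -IH'; congr (_ *: _ + _).
by rewrite (@wgen_wsnoc w' j 0 false k k) //; lia.
Qed.

Lemma leibS_last n m c v : j = k.+2 -> inS j v -> n = (k.+1 + m.+1)%N ->
  dE (ecomp n.+1 j v (psiE m.+1 c)) = ecomp n j (v : E k.+2) (dpsi m.+1 c).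
Proof.
move=> ej hv hn; elim: hv => [|a w u wr wd wb _ IH].
  by rewrite !ecomp0l !raddf0.
rewrite !ecompDl !ecompZl !raddfD /= IH; congr (_ + _).
rewrite !dEZ; congr (_ *: _).
rewrite (@wgen_wsnoc w j m.+1 c k.+1 n) //; try lia.
have [|r d b e] := wsnocP m.+1 c wr wd wb; first by lia.
rewrite dE_wgen ?d // /wsnoc /= word_not_nil //.
have -> : (n - m.+1)%N = k.+1 by lia.
by rewrite ej eqxx.
Qed.

Lemma leibS n m c v : (j <= k.+1)%N -> inS j v -> n = (k.+1 + m.+1)%N ->
  dE (ecomp n.+1 j v (psiE m.+1 c)) =
  ecomp n j (dE (v : E k.+2)) (psiE m.+1 c)
  + (-1) ^+ (k.+2 - j) *: ecomp n j v (dpsi m.+1 c).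
Proof.
move=> ej hv hn; elim: hv => [|a w u wr wd wb _ IH].
  by rewrite !(ecomp0l, raddf0, scaler0) addr0.
rewrite !ecompDl !ecompZl !raddfD /= IH !ecompDl ?scalerDr addrACA; congr (_ + _).
rewrite !dEZ ecompZl.
rewrite scalerA [_ * a]mulrC -scalerA -scalerDr; congr (_ *: _).
rewrite (@wgen_wsnoc w j m.+1 c k.+1 n) //; try lia.
have [|r d b e] := wsnocP m.+1 c wr wd wb; first by lia.
rewrite (dE_wgen wr wd) dE_wgen ?d // /wsnoc /= word_not_nil //.
have -> : (n - m.+1)%N = k.+1 by lia.
by case: eqP => // h; exfalso; lia.
Qed.
End Leibniz.

Lemma dE_psi n c : dE (psiE n c) = dpsi n c.
Proof.
have [r dg b e] := wsnocP n c (erefl (rightmost [::])) (erefl _)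
  (erefl (wbelow 1 [::])) isT.
have -> : psiE n c = wgen (wsnoc [::] (1%N, n, c)) n.
  rewrite /psiE /wgen; congr (@gen _.+1 _); apply: val_inj.
  by rewrite wcell_rightmost //= e raw_comp_unitl.
by rewrite dE_wgen // /wsnoc /=; case: ifP => //= /andP[/eqP-> /negPf->].
Qed.

Lemma dpsi_dE n c : dE (dpsi n.+1 c) = 0.
Proof. by rewrite /= raddfD /= dEZ !dE_psi dpsi2. Qed.

Lemma dword_dE w n : rightmost w -> wdeg w = n.+1 -> dE (dword w n.+1) = 0.
Proof.
elim: w n => [//|[[j m] c] w IH] n wr wd.
have /and4P[hj hmc hb hr] := wr.
have [nw|nw] := boolP (nilp w).
  by rewrite [dword _ _]/= nw dpsi_dE.
have [j2 k1] := rightmost_deg wr nw.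
move: wd; rewrite [dword _ _]/= (negPf nw) [wdeg _]/=.
case ek : (wdeg w) k1 hj => [//|k] _ hj.
have iS : inS j (dword w k.+1) by apply: dword_inS.
have iSp : inS j (wgen w k.+1) by apply: inS_wgen.
case: m hmc {wr} => [_|m _].
  rewrite addn0 => -[ekn]; subst n.
  case: eqP => ej; first by rewrite raddfN /= IH ?oppr0.
  case: k => [|k] in ek hj iS iSp ej *; first by lia.
  have [ej'|ej'] := eqVneq j k.+2.
    by rewrite (leib0_last j2) // IH // scaler0.
  by rewrite (leib0 j2) ?IH ?ecomp0l //; lia.
move=> hn; have -> : (n.+1 - m.+1)%N = k.+1 by lia.
have key : (j <= k.+2)%N -> dE (ecomp n.+1 j (wgen w k.+1) (dpsi m.+1 c)) =
   if j == k.+2 then 0 else ecomp n j (dword w k.+1) (dpsi m.+1 c).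
  move=> _; case: m hn => [|m] hn.
    have -> : n = k.+1 by lia.
    rewrite /= expr0 scale1r ecompDr raddfD /=.
    case: eqP => ej.
      rewrite !(leib0_last j2) // -scalerDl; case: (c) => /=;
      by rewrite ?expr0 ?expr1 ?subrr ?addNr scale0r.
    rewrite !(leib0 j2) //; [|lia|lia].
    by rewrite dE_wgen // -ecompDr.
  rewrite [dpsi m.+2 c]/= ecompDr ecompZr raddfD /= dEZ.
  case: eqP => ej.
    rewrite !(@leibS_last _ _ j2) //; [|lia|lia].
    by rewrite -ecompZr -ecompDr dpsi2 ecomp0r.
  rewrite !(@leibS _ _ j2) //; [|lia|lia|lia|lia].
  rewrite scalerDr addrACA -ecompZr dE_wgen // -ecompDr.
  rewrite scalerA mulrC -scalerA -scalerDr -ecompZr -ecompDr.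
  by rewrite dpsi2 ecomp0r scaler0 addr0.
have hj' : (j <= k.+2)%N by lia.
move: key => /(_ hj'); case: eqP => ej key; first exact: key.
rewrite raddfD /= dEZ key.
case: k => [|k] in ek hj hn iS iSp ej hj' {key} *; first by lia.
have -> : dE (ecomp n.+1 j (dword w k.+2) (psiE m.+1 c)) =
   (-1) ^+ (k.+2 - j) *: ecomp n j (dword w k.+2) (dpsi m.+1 c).
  have [ej'|ej'] := eqVneq j k.+2.
    by rewrite (leibS_last j2) //; [rewrite ej' subnn expr0 scale1r|lia].
  rewrite (leibS j2) //; [|lia|lia].
  by rewrite IH // ecomp0l add0r.
rewrite -scalerDl (_ : (k.+3 - j = (k.+2 - j).+1)%N); last by lia.
by rewrite exprS mulN1r subrr scale0r.
Qed.

Lemma dE_dE n (u : E n.+2) : dE (dE u) = 0.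
Proof.
elim/E_ind: u => [|a x u IH]; first by rewrite !raddf0.
rewrite !raddfD /= IH !dEZ addr0 dE_gen.
have [r e] := rdecP (x : pncp n.+1).
by rewrite dword_dE ?scaler0 // wdeg_rdec.
Qed.

Lemma eE_dE (u : E 1) : eE (dE u) = 0.
Proof.
elim/E_ind: u => [|a x u IH]; first by rewrite !raddf0.
rewrite !raddfD /= IH dEZ eEZ addr0 dE_gen.
have h c : eE (dpsi 0 c) = 0.
  by rewrite eEZ raddfB /= /eE !extend_gen subrr mulr0.
have [c ->] : exists c, dword (rdec (x : pncp 0)) 0 = dpsi 0 c; last by rewrite h mulr0.
have := wdeg_rdec (x : pncp 0); have [+ _] := rdecP (x : pncp 0).
case: (rdec _) => [|[[i m] c] w] wr /= wd; first by exists false.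
have [nw|nw] := boolP (nilp w); first by exists c.
by have [] := rightmost_deg wr nw; lia.
Qed.

Record augComplex := AugComplex {
  chain :> nat -> zmodType;
  bd : forall n, {additive chain n.+1 -> chain n};
  aug : {additive chain 0 -> int};
  bd_bd : forall n (x : chain n.+2), bd n (bd n.+1 x) = 0;
  aug_bd : forall x : chain 1, aug (bd 0 x) = 0 }.

Record is_morphism (C D : augComplex) (f : forall n, C n -> D n) : Prop :=
  IsMorphism {
    morphism_additive : forall n, zmod_morphism (f n);
    morphism_bd : forall n (x : C n.+1), f n (bd C n x) = bd D n (f n.+1 x);
    morphism_aug : forall x : C 0, aug D (f 0 x) = aug C x }.

Definition is_automorphism (C : augComplex) (f : forall n, C n -> C n) : Prop :=
  is_morphism f /\
  exists g : forall n, C n -> C n,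
    is_morphism g /\ forall n, cancel (f n) (g n) /\ cancel (g n) (f n).

Definition Ecomplex : augComplex :=
  @AugComplex E (fun n => @dE n) eE dE_dE eE_dE.

(* Main.v *)
Require Import Defs.
From mathcomp Require Import all_boot all_order all_algebra.
From mathcomp Require Import zify.

Set Implicit Arguments.
Unset Strict Implicit.
Unset Printing Implicit Defensive.

Import GRing.Theory.
Local Open Scope ring_scope.

(** Flipping the first bit commutes with [- o_i q] as soon as [i >= 2], because
    such a composition leaves the first bit of its left argument alone.  In a
    rightmost decomposition every factor but the first sits at a position
    [>= 2]: the first one has position 1, being composed with a partition of
    degree 0, and positions increase.  So [tau] acts on the decomposition by
    flipping the polarity of the first factor only ([tau_wordP]), and the
    recursion defining [d] peels factors off the other end.  An induction on the
    length therefore reduces [tau d = d tau] to the case of a single factor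
    [psi_m^c], where [tau psi_m^c = psi_m^(c+1)] and the formulas for
    [d psi_m^c] are visibly symmetric ([tau_dpsi]); the inductive step is that
    [tau] passes through every composition in the formula for [d]
    ([tau_ecomp], [tau_dword]).

    The one irregularity is the factor [psi_0^1], whose flip [psi_0^0] is the
    unit and is not a legal factor.  It can come first only when it is the whole
    decomposition, since a later factor would need a position [>= 2] in
    something of degree 0; so flipping never shortens a decomposition of length
    at least 2, nor moves it to another clause of the definition of [d]. *)

Lemma tau_gen n (x : cell n) : tau (gen x) = gen (tau_cell x).
Proof. exact: extend_gen. Qed.

Lemma tauZ n a (u : E n) : tau (a *: u) = a *: tau u.
Proof. exact: extendZ. Qed.

Lemma tau_cellK n : involutive (@tau_cell n).
Proof.
case: n => [[] //|n] x; apply: val_inj.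
have /andP[_] := valP (x : pncp n).
rewrite [X in _ -> X = _]/(raw_tau (raw_tau (val x))).
by case: (val x) => p [|b bs] // _; rewrite /raw_tau /= !addbT negbK.
Qed.

Lemma tauK n : involutive (@tau n).
Proof.
elim/E_ind => [|a x u IH]; first by rewrite !raddf0.
by rewrite !raddfD /= IH !tauZ !tau_gen tau_cellK.
Qed.

Lemma eE_tau (u : E 0) : eE (tau u) = eE u.
Proof.
elim/E_ind: u => [|a x u IH]; first by rewrite !raddf0.
by rewrite !raddfD /= IH !tauZ !eEZ tau_gen /eE !extend_gen.
Qed.

(** For [i >= 2] the first bit of the composite is that of [x], and the bit of
    [x] that gets added to those of [y] is not the first one. *)
Lemma raw_tau_comp i (x y : raw_pncp) : (2 <= i)%N -> (0 < size x.2)%N ->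
  raw_tau (raw_comp i x y) = raw_comp i (raw_tau x) y.
Proof. by case: i => [|[|i]] //; case: x => p [|b bs]. Qed.

Lemma tau_psiE n c : tau (psiE n c) = psiE n (~~ c).
Proof.
by rewrite /psiE tau_gen; congr (@gen n.+1 _); apply: val_inj; rewrite /= /raw_tau /= addbT.
Qed.

Lemma tau_dpsi n c : tau (dpsi n c) = dpsi n (~~ c).
Proof.
case: n => [|n]; last by rewrite raddfD /= tauZ !tau_psiE.
rewrite tauZ raddfB /= !tau_gen.
by rewrite -opprB scalerN -scaleNr; case: c; rewrite ?opprK.
Qed.

(** The degrees and the position have to match: otherwise [pcomp] is a default
    value, which [tau] does not fix. *)
Lemma tau_ecomp a b c i (u : E a.+1) (v : E b.+1) :
  (2 <= i <= a.+1)%N -> c = (a + b)%N ->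
  tau (ecomp c.+1 i u v) = ecomp c.+1 i (tau u) v.
Proof.
move=> /andP[i2 ia] ->.
have tau_cells (x : cell a.+1) (y : cell b.+1) :
  tau (ecomp (a + b).+1 i (gen x) (gen y)) =
  ecomp (a + b).+1 i (gen (tau_cell x)) (gen y).
  rewrite !ecomp_gen [LHS]/= tau_gen; congr (@gen _.+1 _); apply: val_inj.
  have i1 : (1 <= i <= a.+1)%N by lia.
  have sx : (0 < size (val x).2)%N by have /andP[_ /eqP->] := valP (x : pncp a).
  rewrite [RHS]val_pcomp // -raw_tau_comp //.
  by rewrite -(val_pcomp (x : pncp a) (y : pncp b) i1).
elim/E_ind: u => [|k x u IHu]; first by rewrite !(ecomp0l, raddf0).
rewrite ecompDl ecompZl !raddfD /= IHu !tauZ ecompDl ecompZl tau_gen.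
suff -> : tau (ecomp (a + b).+1 i (gen x) v) =
          ecomp (a + b).+1 i (gen (tau_cell x)) v by [].
elim/E_ind: v {IHu} => [|l y v IHv]; first by rewrite !(ecomp0r, raddf0).
by rewrite !ecompDr !ecompZr raddfD /= IHv tauZ tau_cells.
Qed.

(** Replacing the innermost factor by its flip.  The empty word is [psi_0^0],
    whose flip has one factor; conversely [wsnoc] drops the flip [psi_0^0] of
    [psi_0^1]. *)
Fixpoint tau_word (w : seq factor) : seq factor :=
  match w with
  | [::] => [:: (1%N, 0%N, true)]
  | (i, m, c) :: w' =>
    if nilp w' then wsnoc [::] (1%N, m, ~~ c) else (i, m, c) :: tau_word w'
  end.

Lemma tau_wordP w : rightmost w ->
  [/\ rightmost (tau_word w), wdeg (tau_word w) = wdeg w,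
      forall j, (2 <= j)%N -> wbelow j w -> wbelow j (tau_word w)
    & weval (tau_word w) = raw_tau (weval w)].
Proof.
elim: w => [|[[i m] c] w IH] wr.
  by split=> //; [move=> j j2 _; rewrite /= /fpos j2|exact: weval_single].
have [nw|nw] := boolP (nilp w).
  move: wr; rewrite (nilP nw) => wr; have ei := rightmost_single wr; subst i.
  have [r d b e] := wsnocP m (~~ c) (erefl (rightmost [::])) (erefl _)
    (erefl (wbelow 1 [::])) isT.
  split=> //; first by move=> j j2 _; apply: wbelow_mono b.
  rewrite [tau_word _]/= e raw_comp_unitl weval_single.
  by rewrite /raw_tau /= addbT.
have [i2 _] := rightmost_deg wr nw.
have /and4P[hi hmc hb hr] := wr; have [r d b e] := IH hr.
rewrite [tau_word _]/= (negPf nw); split.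
- by rewrite /= d hi hmc b.
- by rewrite /= d.
- by move=> j j2 /andP[ij bj]; rewrite /= ij b.
- by rewrite /= e raw_tau_comp // size_weval.
Qed.

Lemma tau_cell_wcell w n : rightmost w -> wdeg w = n ->
  tau_cell (wcell w n : cell n.+1) = wcell (tau_word w) n.
Proof.
move=> wr wd; have [r d _ e] := tau_wordP wr.
by apply: val_inj; rewrite /= !wcell_rightmost ?d.
Qed.

Lemma dword_single n c : dword (wsnoc [::] (1%N, n, c)) n = dpsi n c.
Proof. by rewrite /wsnoc /=; case: ifP => //= /andP[/eqP-> /negPf->]. Qed.

(** The clause of [dword] is selected by the shape of the last factor and by the
    degree of the remaining word, neither of which changes when at least two
    factors are present; each composition in that clause has position [>= 2]. *)
Lemma tau_dword w n : rightmost w -> wdeg w = n ->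
  tau (dword w n) = dword (tau_word w) n.
Proof.
elim: w n => [|[[i m] c] w IH] n wr wd; first by rewrite /= tau_dpsi -wd.
have [nw|nw] := boolP (nilp w).
  have emn : m = n by move: wd; rewrite /= (nilP nw).
  subst m; rewrite [tau_word _]/= nw dword_single -tau_dpsi.
  by rewrite /= nw.
have [i2 k1] := rightmost_deg wr nw.
have /and4P[/andP[_ hi] hmc hb hr] := wr; have [r d _ _] := tau_wordP hr.
have nw' : nilp (tau_word w) = false by move: d k1; case: tau_word => //= <-.
move: wd; rewrite [wdeg _]/= => wd.
rewrite [tau_word _]/= (negPf nw) [LHS]/= [RHS]/= (negPf nw) nw'.
case: m hmc wd {wr} => [_|m _] wd.
  rewrite addn0 in wd; subst n; have IHw := IH _ hr erefl.
  case: eqP => ei; first by rewrite raddfN /= IHw.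
  move: hi k1 ei IHw; case: (wdeg w) => // a hi _ ei IHw.
  by rewrite (@tau_ecomp a 0 a) ?IHw //; lia.
have -> : (n - m.+1)%N = wdeg w by lia.
have tw : tau (wgen w (wdeg w)) = wgen (tau_word w) (wdeg w).
  by rewrite /wgen tau_gen tau_cell_wcell.
(* [d psi_(m+1)^c] involves generators of degree [m], hence the composites with
   it have degree one less than [n]. *)
have -> : n = (wdeg w + m).+1 by lia.
have IHw := IH _ hr erefl.
case: eqP => ei; first by rewrite tau_ecomp ?tw //; lia.
rewrite raddfD /= tauZ (@tau_ecomp (wdeg w) m) ?tw //; last by lia.
move: hi k1 ei IHw; case: (wdeg w) => // a hi _ ei IHw.
by rewrite (@tau_ecomp a m.+1) ?IHw //; lia.
Qed.

Lemma tau_dE n (u : E n.+1) : tau (dE u) = dE (tau u).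
Proof.
elim/E_ind: u => [|a x u IH]; first by rewrite !raddf0.
have [r _] := rdecP (x : pncp n); have d := wdeg_rdec (x : pncp n).
have [r' d' _ _] := tau_wordP r.
suff tdx : tau (dE (gen x)) = dE (gen (tau_cell x)).
  by rewrite !raddfD /= IH dEZ !tauZ dEZ tau_gen tdx.
rewrite dE_gen tau_dword // -dE_wgen ?d' //; congr (dE (@gen n.+1 _)).
by rewrite -tau_cell_wcell // wcell_rdec.
Qed.

Lemma tau_morphism : @is_morphism Ecomplex Ecomplex tau.
Proof.
by split=> [n||]; [exact: raddfB|exact: tau_dE|exact: eE_tau].
Qed.

Theorem proposition2p6 :
  @is_automorphism Ecomplex tau /\ (forall n : nat, involutive (@tau n)).
Proof.
split; last exact: tauK.
split; first exact: tau_morphism.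
by exists tau; split; [exact: tau_morphism|split; exact: tauK].
Qed.
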